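(* Let $\widetilde d_0<\widetilde d_1<\cdots<\widetilde d_{r-1}$ be the ideal weights of the $(2r-1)$th-order WENO scheme sorted in ascending order, let $0<\mathrm{CFS}_0\le\widetilde d_0$, $\widetilde d_{r-1}\le\mathrm{CFS}_1\le1$, $k_0\in[0,\widetilde d_0/\mathrm{CFS}_0]$ and $k_1\in[0,(1-\widetilde d_{r-1})/(1-\mathrm{CFS}_1)]$. For every $s=0,\dots,r-1$ let the mapping function $(g^{\mathrm{MOP-ACM}k})_s$ be the same function (independent of $s$) $$g^{\mathrm{MOP-ACM}k}(\omega)=\begin{cases}k_0\,\omega,&\omega\in\hat\Omega_1,\\ \widetilde d_i,&\omega\in\hat\Omega_{i+2},\ i=0,\dots,r-1,\\ 1-k_1(1-\omega),&\omega\in\hat\Omega_{r+2},\end{cases}$$ on $[0,1]$, where $\hat\Omega_1=[0,\mathrm{CFS}_0)$, $\hat\Omega_2=[\mathrm{CFS}_0,\frac{\widetilde d_0+\widetilde d_1}{2})$, $\hat\Omega_{i+2}=[\frac{\widetilde d_{i-1}+\widetilde d_i}{2},\frac{\widetilde d_i+\widetilde d_{i+1}}{2})$ for $1\le i\le r-2$, $\hat\Omega_{r+1}=[\frac{\widetilde d_{r-2}+\widetilde d_{r-1}}{2},\mathrm{CFS}_1]$ and $\hat\Omega_{r+2}=(\mathrm{CFS}_1,1]$. Then the mapping function $g^{\mathrm{MOP-ACM}k}(\omega)$ is order-preserving (OP).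
   Context: Ideal weights: the ideal weights $d_0,\dots,d_{r-1}$ of the $(2r-1)$th-order WENO scheme are the constants that combine the $r$ candidate $r$-point substencil approximations into the $(2r-1)$th-order approximation in smooth regions (for $r=3$: $d_0=0.1$, $d_1=0.6$, $d_2=0.3$, so $\widetilde d_0=0.1$, $\widetilde d_1=0.3$, $\widetilde d_2=0.6$). Monotone increasing piecewise mapping function: a mapping function $g$ on $[0,1]$, where $[0,1]$ is divided into nonoverlapping intervals $\Omega_1,\dots,\Omega_M$, such that (C1) at every $\omega$ in some $\Omega_i$ not on the boundary of $\Omega_i$, $g$ is differentiable with $g'(\omega)\ge0$; (C2) for all $\omega_i,\omega_j\in[0,1]$ with $\omega_i\ge\omega_j$, $g(\omega_i)\ge g(\omega_j)$. Order-preserving: given monotone increasing piecewise mapping functions $g_s$, $s=0,\dots,r-1$, of a $(2r-1)$th-order mapped WENO scheme, the set $\{g_s: s=0,\dots,r-1\}$ is order-preserving (OP) if for all $\omega_a\ge\omega_b$, $$g_m(\omega_a)\ge g_n(\omega_b)\quad\text{for all } m,n\in\{0,\dots,r-1\},$$ where the equality holds if and only if $\omega_a=\omega_b$. That $g^{\mathrm{MOP-ACM}k}$ is order-preserving means that the set $\{(g^{\mathrm{MOP-ACM}k})_s: s=0,\dots,r-1\}$ is order-preserving.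
   Formalization: The clause ''equality iff ω_a = ω_b'' in OP is false here since g is constant on [CFS_0, (d̃_0+d̃_1)/2); it is corrected to: equality iff ω_a = ω_b or both points lie in one common interval of the partition on which the mapping is constant. *)

(* Defs.v *)
From mathcomp Require Import all_boot all_order all_algebra.
From mathcomp Require Import all_classical all_reals all_analysis.

Set Implicit Arguments.
Unset Strict Implicit.
Unset Printing Implicit Defensive.

Import Order.TTheory GRing.Theory Num.Theory.
Import numFieldNormedType.Exports.

Local Open Scope classical_set_scope.
Local Open Scope ring_scope.

(* The grid is uniform with unit spacing.  The 2r-1 cells of the global stencil
   are numbered 0, ..., 2r-2 and cell l is [l, l+1].  The reconstruction point
   x_{j+1/2} is the right end of the central cell number r-1, i.e. the point r.
   The substencil S_s consists of the cells s, ..., s+r-1. *)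

Definition cell_average (R : realType) (p : {poly R}) (l : nat) : R :=
  (\int[@lebesgue_measure R]_(x in `[(l%:R : R), l.+1%:R]) p.[x])%R.

(* p is the polynomial of degree < n having the prescribed cell averages v on
   the n cells a, ..., a+n-1. *)
Definition reconstructs (R : realType) (v : nat -> R) (a n : nat)
    (p : {poly R}) : Prop :=
  (size p <= n)%N /\
  forall l : nat, (a <= l < a + n)%N -> cell_average p l = v l.

(* For arbitrary cell averages, the d-combination of the r substencil
   approximations is the (2r-1)th-order approximation of the global stencil.
   For r = 3 this gives d = (1/10, 6/10, 3/10). *)
Definition ideal_weights (R : realType) (r : nat) (d : 'I_r -> R) : Prop :=
  forall (v : nat -> R) (q : 'I_r -> {poly R}) (P : {poly R}),
    (forall s : 'I_r, reconstructs v s r (q s)) ->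
    reconstructs v 0 (2 * r).-1 P ->
    \sum_(s < r) d s * (q s).[r%:R] = P.[r%:R].

(* Pieces are allowed to be empty. *)
Definition monotone_piecewise (R : realType) (M : nat)
    (Omega : 'I_M -> interval R) (g : R -> R) : Prop :=
  [/\ cover [set: 'I_M] (fun i => [set` Omega i]) = [set` `[(0 : R), 1]],
      trivIset [set: 'I_M] (fun i => [set` Omega i]),
      forall (i : 'I_M) (w : R), interior [set` Omega i] w ->
        derivable g w 1 /\ 0 <= derive1 g w
    & forall wi wj : R, wi \in `[(0 : R), 1] -> wj \in `[(0 : R), 1] ->
        wj <= wi -> g wj <= g wi].

Definition same_flat_piece (R : realType) (M : nat)
    (Omega : 'I_M -> interval R) (g : R -> R) (x y : R) : Prop :=
  exists i : 'I_M, [/\ x \in Omega i, y \in Omega i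
    & forall z : R, z \in Omega i -> g z = g x].

(* In the equality clause, two points of a piece on which a mapping is constant
   have to be tolerated: "equality iff wa = wb", without this proviso, fails for
   every mapping with a nondegenerate constant piece.  For mappings without such
   pieces the clause reads exactly "equality iff wa = wb". *)
Definition order_preserving (R : realType) (r M : nat)
    (Omega : 'I_r -> 'I_M -> interval R) (g : 'I_r -> R -> R) : Prop :=
  (forall s : 'I_r, monotone_piecewise (Omega s) (g s)) /\
  forall wa wb : R, wa \in `[(0 : R), 1] -> wb \in `[(0 : R), 1] -> wb <= wa ->
  forall m n : 'I_r,
    g n wb <= g m wa /\
    (g m wa = g n wb <->
       wa = wb \/ (same_flat_piece (Omega m) (g m) wa wb /\
                   same_flat_piece (Omega n) (g n) wa wb)).

Definition midpoint (R : realType) (dt : seq R) (i : nat) : R :=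
  (dt`_i + dt`_i.+1) / 2.

(* Index j stands for the (j+1)st interval: j = 0 and j = r+1 are the two outer
   intervals, and j = i+1 with i < r is the one mapped to dt`_i. *)
Definition acmk_interval (R : realType) (r : nat) (dt : seq R) (CFS0 CFS1 : R)
    (j : 'I_r.+2) : interval R :=
  if j == 0%N :> nat then `[0, CFS0[
  else if j == r.+1 :> nat then `]CFS1, 1]
  else let i := j.-1 in
    Interval
      (BLeft (if i == 0%N then CFS0 else midpoint dt i.-1))
      (if i == r.-1 then BRight CFS1 else BLeft (midpoint dt i)).

Definition acmk_branch (R : realType) (r : nat) (dt : seq R) (k0 k1 : R)
    (j : 'I_r.+2) (w : R) : R :=
  if j == 0%N :> nat then k0 * w
  else if j == r.+1 :> nat then 1 - k1 * (1 - w)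
  else dt`_j.-1.

(* The value 0 is a dummy one, taken only outside [0, 1]. *)
Definition mop_acmk (R : realType) (r : nat) (dt : seq R)
    (CFS0 CFS1 k0 k1 : R) (w : R) : R :=
  if [pick j : 'I_r.+2 | w \in acmk_interval dt CFS0 CFS1 j] is Some j
  then acmk_branch dt k0 k1 j w else 0.

(* Main.v *)
Require Import Defs.
From mathcomp Require Import all_boot all_order all_algebra.
From mathcomp Require Import all_classical all_reals all_analysis.
From mathcomp Require Import ring lra zify.

Import Order.TTheory GRing.Theory Num.Theory.
Import numFieldNormedType.Exports.

Local Open Scope classical_set_scope.
Local Open Scope ring_scope.

(** Since all the mappings of the family are the same function [g], order
    preservation is a statement about [g] alone: it is nondecreasing, and two
    points share a value only if they coincide or lie in a common piece on
    which [g] is constant.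

    The pieces are the intervals between consecutive members of a nondecreasing
    chain of interval bounds running from the left of 0 to the right of 1; this
    alone makes them a partition of [0, 1] listed from left to right.  On each
    piece [g] is affine with a nonnegative slope, hence there it is either
    strictly increasing or constant.  So everything reduces to showing that [g]
    increases strictly from one piece to any later one
    ([order_preserving_affine_pieces]).

    For the mapping at hand this strict increase is [acmk_branch_lt].  The
    middle pieces carry the increasing values [dt`_0 < ... < dt`_r.-1].  The
    first piece stops short of [CFS0], so that [k0 <= dt`_0 / CFS0] keeps its
    values strictly below [dt`_0].  Symmetrically the last piece starts strictly
    after [CFS1], so that the bound on [k1] keeps its values strictly above
    [dt`_r.-1].  The extreme cases [k0 = 0] and [k1 = 0] produce the constant
    values 0 and 1, which are still different from the sorted weights because
    [0 < CFS0 <= dt`_0], and [dt`_r.-1 <= CFS1 < 1] when the last piece is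
    nonempty. *)

(** * Intervals cut out by a chain of bounds *)

Lemma chain_itv_lt {d : Order.disp_t} {T : porderType d}
    {b : nat -> itv_bound T} {i j : nat} {x y : T} :
  {homo b : m n / (m <= n)%N >-> (m <= n)%O} -> (i < j)%N ->
  x \in Interval (b i) (b i.+1) -> y \in Interval (b j) (b j.+1) -> (x < y)%O.
Proof.
move=> b_homo lt_ij; rewrite !itv_boundlr => /andP[_ xb] /andP[yb _].
by have := le_trans (le_trans xb (b_homo _ _ lt_ij)) yb; rewrite bnd_simp.
Qed.

Lemma chain_itv_disjoint {d : Order.disp_t} {T : porderType d}
    {b : nat -> itv_bound T} {i j : nat} (x : T) :
  {homo b : m n / (m <= n)%N >-> (m <= n)%O} ->
  x \in Interval (b i) (b i.+1) -> x \in Interval (b j) (b j.+1) -> i = j.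
Proof.
move=> b_homo xi xj; case: (ltngtP i j) => // [ij|ji].
  by have := chain_itv_lt b_homo ij xi xj; rewrite ltxx.
by have := chain_itv_lt b_homo ji xj xi; rewrite ltxx.
Qed.

(** The piece of a point is the last one whose lower bound lies to its left. *)
Lemma chain_itv_cover (d : Order.disp_t) (T : orderType d)
    (b : nat -> itv_bound T) (n : nat) (x : T) :
  x \in Interval (b 0) (b n) ->
  exists2 j, (j < n)%N & x \in Interval (b j) (b j.+1).
Proof.
elim: n => [|n IHn] xbn; first by have := lt_in_itv xbn; rewrite ltxx.
have [xb|] := boolP (BRight x <= b n)%O.
  have [|j jn xj] := IHn.
    by move: xbn; rewrite !itv_boundlr xb andbT => /andP[].
  by exists j => //; exact: ltnW.
rewrite -ltNge ltBRight_leBLeft => bx; exists n => //.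
by move: xbn; rewrite !itv_boundlr bx => /andP[].
Qed.

(** * Piecewise affine mappings *)

Lemma is_derive1_affine {R : realType} (a c w : R) :
  is_derive w 1 (fun x => a * x + c) a.
Proof.
have := is_deriveD (is_deriveZ a (is_derive_id w (1 : R))) (is_derive_cst c w 1).
by rewrite addr0 /GRing.scale /= mulr1; exact.
Qed.

(** Strict increase across the pieces is all that has to be checked: inside a
    piece an affine function of nonnegative slope is nondecreasing, and takes a
    value twice only if its slope is zero, that is, on a flat piece. *)
Lemma order_preserving_affine_pieces {R : realType} {r M : nat}
    {Omega : 'I_M -> interval R} {g : R -> R} (b : nat -> itv_bound R)
    (a c : 'I_M -> R) :
  {homo b : m n / (m <= n)%N >-> (m <= n)%O} ->
  b 0%N = BLeft 0 -> b M = BRight 1 ->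
  (forall j, Omega j = Interval (b j) (b j.+1)) ->
  (forall j, 0 <= a j) ->
  (forall j x, x \in Omega j -> g x = a j * x + c j) ->
  (forall (i j : 'I_M) x y, (i < j)%N -> x \in Omega i -> y \in Omega j ->
     g x < g y) ->
  order_preserving (fun _ : 'I_r => Omega) (fun _ : 'I_r => g).
Proof.
move=> b_homo b0 bM OmegaE a_ge0 gE g_lt.
have Omega_cover x : x \in `[0, 1] -> exists j, x \in Omega j.
  rewrite -b0 -bM => /chain_itv_cover[j jM xj].
  by exists (Ordinal jM); rewrite OmegaE.
have Omega_le (i j : 'I_M) x y :
    x \in Omega i -> y \in Omega j -> x < y -> (i <= j)%N.
  rewrite !OmegaE => xi yj xy; rewrite leqNgt; apply/negP => ji.
  have := chain_itv_lt b_homo ji yj xi.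
  by move=> /(lt_trans xy); rewrite ltxx.
have g_le x y : x \in `[0, 1] -> y \in `[0, 1] -> x <= y -> g x <= g y.
  move=> /Omega_cover[i xi] /Omega_cover[j yj].
  rewrite le_eqVlt => /predU1P[->//|xy].
  have := Omega_le _ _ _ _ xi yj xy; rewrite leq_eqVlt => /orP[/eqP/val_inj ij|].
    by subst j; rewrite (gE _ _ xi) (gE _ _ yj) lerD2r ler_wpM2l // ltW.
  by move=> ij; exact/ltW/(g_lt i j).
have g_eq x y : x \in `[0, 1] -> y \in `[0, 1] -> x < y -> g x = g y ->
    exists i, [/\ x \in Omega i, y \in Omega i &
      forall z, z \in Omega i -> g z = g x].
  move=> /Omega_cover[i xi] /Omega_cover[j yj] xy gxy.
  have := Omega_le _ _ _ _ xi yj xy; rewrite leq_eqVlt => /orP[/eqP/val_inj ij|].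
    subst j; exists i; split=> // z zi; move: gxy.
    rewrite (gE _ _ xi) (gE _ _ yj) (gE _ _ zi) => gxy.
    have /eqP : a i * (y - x) = 0 by lra.
    rewrite mulf_eq0 => /orP[/eqP ->|]; first by rewrite !mul0r.
    by rewrite subr_eq0 (gt_eqF xy).
  by move=> ij; have := g_lt _ _ _ _ ij xi yj; rewrite gxy ltxx.
split=> [_|wa wb wa01 wb01 le_ba m n].
  split=> [||i w wi|wi wj wi01 wj01 wji]; last exact: g_le.
  - apply/seteqP; split=> [x [j _ /= xj]|x /= /Omega_cover[j xj]]; last by exists j.
    move: xj; rewrite OmegaE !itv_boundlr -b0 -bM => /andP[bx xb].
    by rewrite (le_trans (b_homo _ _ (leq0n j)) bx) (le_trans xb) // b_homo.
  - move=> i j _ _ [x [/= xi xj]]; apply: val_inj.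
    by apply: (chain_itv_disjoint x b_homo); rewrite -OmegaE.
  - have near_gE : \forall x \near w, a i * x + c i = g x.
      by apply: filterS wi => x /= xi; rewrite (gE _ _ xi).
    have [? dg] := near_eq_is_derive near_gE (is_derive1_affine (a i) (c i) w).
    by rewrite derive1E dg.
split; first exact: g_le.
split=> [gab|[->//|[[i [wai wbi flat]] _]]]; last by rewrite (flat wb).
move: le_ba; rewrite le_eqVlt => /predU1P[->|lt_ba]; [by left|right].
have [i [wbi wai flat]] := g_eq _ _ wb01 wa01 lt_ba (esym gab).
by split; exists i; split=> // z zi; rewrite flat.
Qed.

(** * The mapping *)

(** The ends of the pieces.  Only the last cut, at [CFS1], belongs to the piece
    on its left; beyond the index [r.+2] the chain is constant. *)
Definition acmk_bound {R : realType} (r : nat) (dt : seq R) (CFS0 CFS1 : R)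
    (j : nat) : itv_bound R :=
  if j == 0%N then BLeft 0
  else if j == 1%N then BLeft CFS0
  else if (j <= r)%N then BLeft (midpoint dt j.-2)
  else if j == r.+1 then BRight CFS1
  else BRight 1.

Lemma acmk_intervalE {R : realType} {r : nat} (dt : seq R) (CFS0 CFS1 : R)
    (j : 'I_r.+2) :
  (1 < r)%N ->
  acmk_interval dt CFS0 CFS1 j =
  Interval (acmk_bound r dt CFS0 CFS1 j) (acmk_bound r dt CFS0 CFS1 j.+1).
Proof.
case: j => j /= jr hr; rewrite /acmk_interval /acmk_bound /=.
case: j jr => [|[|j]] jr //=.
  have -> : (1 == r.+1 :> nat) = false by lia.
  have -> : (0 == r.-1 :> nat) = false by lia.
  by rewrite hr.
rewrite !eqSS; have [->|jr1] := eqVneq j.+1 r.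
  rewrite ltnn; have -> : (r.+1 < r)%N = false by lia.
  by have -> : (r.+1 == r)%N = false by lia.
have -> : (j.+1 < r)%N by lia.
have [j1r|j1r] := eqVneq j.+1 r.-1.
  have -> : (j.+2 < r)%N = false by lia.
  by have -> : (j.+2 == r)%N by lia.
by have -> : (j.+2 < r)%N by lia.
Qed.

Section Acmk.
Context {R : realType} {r : nat} (dt : seq R) {CFS0 CFS1 k0 k1 : R}.
Hypotheses (hr : (1 < r)%N) (size_dt : size dt = r) (dt_sorted : sorted <%R dt).
Hypotheses (CFS0_bnd : 0 < CFS0 <= dt`_0) (CFS1_bnd : dt`_r.-1 <= CFS1 <= 1).
Hypotheses (k0_bnd : 0 <= k0 <= dt`_0 / CFS0) (k1_ge0 : 0 <= k1).
Hypothesis k1_le : CFS1 < 1 -> k1 <= (1 - dt`_r.-1) / (1 - CFS1).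

(* Index arithmetic only: the real-valued hypotheses would slow lia down. *)
Ltac idx_lia := clear dependent R; lia.

Let dt_lt i j : (i < j < r)%N -> dt`_i < dt`_j.
Proof.
by case/andP=> ij jr; apply: (sorted_ltn_nth lt_trans) => //;
  rewrite inE size_dt // (ltn_trans ij).
Qed.

Let dt_le i j : (i <= j < r)%N -> dt`_i <= dt`_j.
Proof.
case/andP; rewrite leq_eqVlt => /predU1P[->//|ij jr].
by rewrite ltW // dt_lt // ij.
Qed.

Lemma acmk_bound_homo :
  {homo acmk_bound r dt CFS0 CFS1 : m n / (m <= n)%N >-> (m <= n)%O}.
Proof.
apply: homo_leq => [//|y x z|j]; first exact: le_trans.
have /andP[? ?] := CFS0_bnd; have /andP[? ?] := CFS1_bnd.
case: j => [|[|j]]; rewrite /acmk_bound /=.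
- by rewrite bnd_simp ltW.
- have : dt`_0 < dt`_1 by apply: dt_lt; idx_lia.
  by rewrite hr bnd_simp /midpoint; lra.
- rewrite !eqSS; have [jr|jr] := ltnP j.+1 r; last first.
    have -> : (j.+2 < r)%N = false by idx_lia.
    have -> : (j.+2 == r)%N = false by idx_lia.
    by case: eqP => _; rewrite bnd_simp.
  have dtj : dt`_j < dt`_j.+1 by apply: dt_lt; idx_lia.
  have [j2r|j2r] := ltnP j.+2 r.
    have : dt`_j.+1 < dt`_j.+2 by apply: dt_lt; idx_lia.
    by rewrite bnd_simp /midpoint; lra.
  have -> : (j.+2 == r)%N by idx_lia.
  have : dt`_j.+1 <= dt`_r.-1 by apply: dt_le; idx_lia.
  by rewrite bnd_simp /midpoint; lra.
Qed.

Lemma mop_acmkE (j : 'I_r.+2) (x : R) :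
  x \in acmk_interval dt CFS0 CFS1 j ->
  mop_acmk r dt CFS0 CFS1 k0 k1 x = acmk_branch dt k0 k1 j x.
Proof.
move=> xj; rewrite /mop_acmk; case: pickP => [i xi|/(_ j)]; last by rewrite xj.
have -> // : i = j; apply: val_inj.
by apply: (chain_itv_disjoint x acmk_bound_homo); rewrite -acmk_intervalE.
Qed.

(** The slope bound says that the line reaches at most [dt`_0] at [CFS0], which
    the piece excludes; for [k0 = 0] the strictness comes from [0 < dt`_0]. *)
Lemma acmk_branch_first_lt (x : R) : x < CFS0 -> k0 * x < dt`_0.
Proof.
move=> xC; have /andP[C0 Cd] := CFS0_bnd; have /andP[k0_ge0] := k0_bnd.
rewrite ler_pdivlMr // => k0C.
have [->|k0_neq0] := eqVneq k0 0; first by rewrite mul0r (lt_le_trans C0).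
by apply: lt_le_trans k0C; rewrite ltr_pM2l // lt0r k0_neq0.
Qed.

Lemma acmk_branch_last_gt (x : R) :
  CFS1 < x -> x <= 1 -> dt`_r.-1 < 1 - k1 * (1 - x).
Proof.
move=> Cx x1; have /andP[dC _] := CFS1_bnd.
have C1 := lt_le_trans Cx x1; have := k1_le C1.
rewrite ler_pdivlMr ?subr_gt0 // => k1C.
have [->|k1_neq0] := eqVneq k1 0; first by rewrite mul0r subr0 (le_lt_trans dC).
have : k1 * (1 - x) < k1 * (1 - CFS1).
  by rewrite ltr_pM2l ?lt0r ?k1_neq0 // ltrD2l ltrN2.
lra.
Qed.

(** Separating the values of two pieces always goes through the sorted weights:
    the values of an outer piece lie strictly beyond the nearest weight. *)
Lemma acmk_branch_lt (i j : 'I_r.+2) (x y : R) :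
  (i < j)%N -> x \in acmk_interval dt CFS0 CFS1 i ->
  y \in acmk_interval dt CFS0 CFS1 j ->
  acmk_branch dt k0 k1 i x < acmk_branch dt k0 k1 j y.
Proof.
case: i j => [i ir] [j jr] /= ij; rewrite /acmk_interval /acmk_branch /=.
have -> : (j == 0)%N = false by idx_lia.
have -> : (i == r.+1)%N = false by idx_lia.
have first_lt : x \in `[0, CFS0[ -> k0 * x < dt`_0.
  by rewrite in_itv /= => /andP[_]; exact: acmk_branch_first_lt.
have last_gt : y \in `]CFS1, 1] -> dt`_r.-1 < 1 - k1 * (1 - y).
  by rewrite in_itv /= => /andP[]; exact: acmk_branch_last_gt.
case: (eqVneq i 0%N) => [_|i0]; case: (eqVneq j r.+1) => [_|jr1].
- move=> /first_lt xd /last_gt; apply: lt_trans.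
  by apply: (lt_le_trans xd); apply: dt_le; idx_lia.
- by move=> /first_lt xd _; apply: (lt_le_trans xd); apply: dt_le; idx_lia.
- by move=> _ /last_gt; apply: le_lt_trans; apply: dt_le; idx_lia.
- by move=> _ _; apply: dt_lt; idx_lia.
Qed.

Lemma mop_acmk_order_preserving :
  order_preserving
    (fun _ : 'I_r => @acmk_interval R r dt CFS0 CFS1)
    (fun _ : 'I_r => @mop_acmk R r dt CFS0 CFS1 k0 k1).
Proof.
pose slope (j : 'I_r.+2) :=
  if j == 0%N :> nat then k0 else if j == r.+1 :> nat then k1 else 0.
pose offset (j : 'I_r.+2) :=
  if j == 0%N :> nat then 0 else if j == r.+1 :> nat then 1 - k1 else dt`_j.-1.
apply: (order_preserving_affine_pieces
          (acmk_bound r dt CFS0 CFS1) slope offset).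
- exact: acmk_bound_homo.
- by [].
- rewrite /acmk_bound /= !eqSS.
  have -> : (r.+1 < r)%N = false by idx_lia.
  by have -> : (r.+1 == r)%N = false by idx_lia.
- by move=> j; rewrite acmk_intervalE.
- by move=> j; rewrite /slope; case: ifP => _; [have /andP[] := k0_bnd|case: ifP].
- move=> j x xj; rewrite (mop_acmkE _ _ xj) /acmk_branch /slope /offset.
  by case: ifP => _; [|case: ifP => _]; ring.
- move=> i j x y ij xi yj.
  by rewrite (mop_acmkE _ _ xi) (mop_acmkE _ _ yj); exact: acmk_branch_lt.
Qed.

End Acmk.

Theorem lemma6 (R : realType) (r : nat) (d : 'I_r -> R) (dt : seq R)
    (CFS0 CFS1 k0 k1 : R)
    (hr : (1 < r)%N)
    (hd : ideal_weights d)
    (hperm : perm_eq dt (codom d))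
    (hsorted : sorted <%R dt)
    (hCFS0 : 0 < CFS0 <= dt`_0)
    (hCFS1 : dt`_r.-1 <= CFS1 <= 1)
    (hk0 : 0 <= k0 <= dt`_0 / CFS0)
    (hk1 : 0 <= k1)
    (* for CFS1 = 1 the upper bound on k1 is +oo *)
    (hk1' : CFS1 < 1 -> k1 <= (1 - dt`_r.-1) / (1 - CFS1)) :
  order_preserving
    (fun _ : 'I_r => @acmk_interval R r dt CFS0 CFS1)
    (fun _ : 'I_r => @mop_acmk R r dt CFS0 CFS1 k0 k1).
Proof.
apply: mop_acmk_order_preserving => //.
by rewrite (perm_size hperm) size_codom card_ord.
Qed.
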